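(* Let $\mathbf{V}$ be a pseudovariety of groups that is closed under extensions with abelian kernel, let $X$ be a finite set, let $F$ be the free group on $X$, and let $H$ be a finitely generated subgroup of $F$. If $H$ is closed in the pro-$\mathbf{V}$ topology of $F$, then the Stallings graph $\mathcal{S}(H)$ is a labelled subgraph of some finite connected $X$-labelled graph $\mathcal{S}(H)^+$ that is a covering and whose group of deck transformations (in the sense defined in the context) lies in $\mathbf{V}$.
   Context: A pseudovariety of groups is a class $\mathbf{V}$ of finite groups (closed under isomorphism) closed under subgroups, quotients, and finite direct products. It is closed under extensions with abelian kernel if, for every normal abelian subgroup $N\trianglelefteq G$ of a group $G$, $N,G/N\in\mathbf{V}$ imply $G\in\mathbf{V}$. The pro-$\mathbf{V}$ topology of a group $G$ is the group topology for which the normal subgroups $N\trianglelefteq G$ with $G/N\in\mathbf{V}$ form a neighborhood base at the identity. Graphs are finite and in the sense of Serre: each edge $e$ has an initial vertex $\alpha(e)$, a terminal vertex $\omega(e)$, and a reverse edge $\bar e\neq e$ with $\bar{\bar e}=e$, $\alpha(\bar e)=\omega(e)$, $\omega(\bar e)=\alpha(e)$. An $X$-labelled graph has a label $\ell(e)\in X\sqcup X^{-1}$ on each edge $e$, with $\ell(\bar e)=\ell(e)^{-1}$. It is an immersion (resp. covering) if for each vertex $v$ and each $a\in X\sqcup X^{-1}$ there is at most one (resp. exactly one) edge with initial vertex $v$ and label $a$. Stallings graph: a pair $(e_1,e_2)$ of distinct edges is admissible if $e_2\neq\bar e_1$, $\alpha(e_1)=\alpha(e_2)$ and $\ell(e_1)=\ell(e_2)$;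 folding it means identifying $e_1\sim e_2$, $\bar e_1\sim\bar e_2$ and $\omega(e_1)\sim\omega(e_2)$. Given a finitely generated subgroup $H=\langle w_1,\dots,w_m\rangle\leq F$ with each $w_i$ a reduced word, take the wedge at a basepoint $v$ of $m$ cycles $C_1,\dots,C_m$, where $C_i$ has length $|w_i|$ and is labelled by the word $w_i$ when read starting from $v$; then repeatedly fold until no admissible pairs remain. The resulting finite connected based graph $(\mathcal{S}(H),v)$ is the Stallings graph of $H$; it is an immersion. Group of deck transformations: if $\Delta$ is a finite covering with vertex set $V$, then $F$ acts on $V$ on the right, where $u\cdot w$ is the terminal vertex of the unique path in $\Delta$ starting at $u$ with label $w$. The ''group of deck transformations'' of $\Delta$ is the group of permutations of $V$ induced by this action, i.e. the quotient of $F$ by the kernel of the action. For $\Delta$ connected with basepoint $v$, and $U=\pi_1(\Delta,v)\leq F$ the subgroup of labels of loops at $v$, it is isomorphic to $F/U_F$, where $U_F=\bigcap_{g\in F}gUg^{-1}$. *)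

(* Defs.v *)
From HB Require Import structures.
From mathcomp Require Import all_boot all_fingroup.

Set Implicit Arguments.
Unset Strict Implicit.
Unset Printing Implicit Defensive.

Local Open Scope group_scope.

Definition group_class := forall gT : finGroupType, {group gT} -> Prop.

(* The empty family in [pv_prod] puts the trivial group in [V]. *)
Record pseudovariety (V : group_class) : Prop := Pseudovariety {
  pv_isog : forall (gT rT : finGroupType) (G : {group gT}) (H : {group rT}),
    G \isog H -> V gT G -> V rT H;
  pv_sub : forall (gT : finGroupType) (G H : {group gT}),
    H \subset G -> V gT G -> V gT H;
  pv_quo : forall (gT : finGroupType) (G N : {group gT}),
    N <| G -> V gT G -> V (coset_of N) (G / N)%G;
  pv_prod : forall (I : finType) (gT : I -> finGroupType)
                   (G : forall i, {group gT i}),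
    (forall i, V (gT i) (G i)) -> V _ (setXn_group G)
}.

Definition closed_abelian_ext (V : group_class) : Prop :=
  forall (gT : finGroupType) (G N : {group gT}),
    N <| G -> abelian N -> V gT N -> V (coset_of N) (G / N)%G -> V gT G.

Section Groups.
Variable F : groupType.
Implicit Types (H K N A : F -> Prop).

Definition is_subgroup H : Prop :=
  [/\ H 1, forall x y, H x -> H y -> H (x * y) & forall x, H x -> H x^-1].

Definition is_normal N : Prop :=
  is_subgroup N /\ forall x g, N x -> N (g * x * g^-1).

Definition generated (m : nat) (w : 'I_m -> F) : F -> Prop := fun g =>
  forall K, is_subgroup K -> (forall i, K (w i)) -> K g.

Definition generates (m : nat) (w : 'I_m -> F) H : Prop :=
  forall g, H g <-> generated w g.

Definition finitely_generated H : Prop :=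
  exists (m : nat) (w : 'I_m -> F), generates w H.

(* [F / N] belongs to [V]. As [F] need not be finite, the quotient is presented
   as a finite group [Q] together with a surjective morphism from [F] onto [Q]
   with kernel [N]; [V] being isomorphism-closed, the choice is immaterial. *)
Definition quotient_in (V : group_class) N : Prop :=
  exists (gT : finGroupType) (Q : {group gT}) (f : F -> gT),
    [/\ {morph f : x y / x * y},
        forall q, q \in Q <-> exists x, f x = q,
        forall x, N x <-> f x = 1
      & V gT Q].

Definition proV_open (V : group_class) A : Prop :=
  forall g, A g -> exists N,
    [/\ is_normal N, quotient_in V N & forall n, N n -> A (g * n)].

Definition proV_closed (V : group_class) A : Prop :=
  proV_open V (fun g => ~ A g).

End Groups.

(* [(x, true)] stands for [x], and [(x, false)] for its formal inverse. *)
Notation letter X := (X * bool)%type.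

Definition linv (X : finType) (a : letter X) : letter X := (a.1, ~~ a.2).

Definition reduced (X : finType) (w : seq (letter X)) : bool :=
  sorted [rel a b | b != linv a] w.

Record free (X : finType) := Free { word :> seq (letter X); _ : reduced word }.

HB.instance Definition _ (X : finType) := [isSub for @word X].
HB.instance Definition _ (X : finType) := [Choice of free X by <:].

Section FreeGroup.
Variable X : finType.
Implicit Types (a b : letter X) (u v w : seq (letter X)).

Definition push a w : seq (letter X) :=
  if w is b :: w' then if b == linv a then w' else a :: w else [:: a].

Lemma linvK : involutive (@linv X).
Proof. by case=> x b; rewrite /linv /= negbK. Qed.

Lemma linv_neq a : linv a != a.
Proof. by case: a => x [] ; rewrite /linv xpair_eqE /= andbF. Qed.

Lemma reduced_cons a w : reduced (a :: w) -> reduced w.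
Proof. by rewrite /reduced; case: w => //= b w /andP[]. Qed.

Lemma push_reduced a w : reduced w -> reduced (push a w).
Proof.
case: w => //= b w rw; case: eqP => [_|/eqP nb]; first exact: reduced_cons rw.
by rewrite /reduced /= nb.
Qed.

Lemma push_cons a w : reduced (a :: w) -> push a w = a :: w.
Proof. by rewrite /reduced; case: w => //= b w /andP[/negPf->]. Qed.

Lemma pushK a w : reduced w -> push (linv a) (push a w) = w.
Proof.
case: w => [|b w] rw /=; first by rewrite linvK eqxx.
by case: eqP => [eb|_]; [rewrite -eb push_cons | rewrite /= linvK eqxx].
Qed.

Lemma foldr_reduced u v : reduced v -> reduced (foldr push v u).
Proof. by move=> rv; elim: u => //= a u; apply: push_reduced. Qed.

Lemma foldr_push a v w : reduced w -> reduced v ->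
  foldr push w (push a v) = push a (foldr push w v).
Proof.
move=> rw; case: v => //= b v rv; case: eqP => //= ->.
by rewrite -{1}[a]linvK pushK //; apply: foldr_reduced.
Qed.

Lemma foldr_foldr u v w : reduced w -> reduced v ->
  foldr push w (foldr push v u) = foldr push (foldr push w v) u.
Proof.
move=> rw rv; elim: u => //= a u IHu.
by rewrite foldr_push ?IHu //; apply: foldr_reduced.
Qed.

Lemma foldr_nil u : reduced u -> foldr push [::] u = u.
Proof.
by elim: u => //= a u IHu ru; rewrite IHu ?push_cons //; apply: reduced_cons ru.
Qed.

Definition winv w : seq (letter X) := rev (map (@linv X) w).

Lemma winvK : involutive winv.
Proof. by move=> w; rewrite /winv map_rev revK -map_comp (eq_map linvK) map_id. Qed.

Lemma winv_reduced w : reduced w -> reduced (winv w).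
Proof.
rewrite /reduced /winv rev_sorted sorted_map; apply: sub_sorted => a b /=.
by rewrite linvK; apply: contra => /eqP->.
Qed.

Lemma foldr_winv u v : reduced v -> foldr push (foldr push v u) (winv u) = v.
Proof.
move=> rv; elim: u => //= a u IHu.
by rewrite /winv /= rev_cons -cats1 foldr_cat /= pushK //; apply: foldr_reduced.
Qed.

Definition free_one : free X := @Free X [::] isT.
Definition free_mul (u v : free X) : free X :=
  Free (foldr_reduced u (valP v)).
Definition free_inv (u : free X) : free X := Free (winv_reduced (valP u)).

Lemma free_mulA : associative free_mul.
Proof. by move=> u v w; apply/val_inj; rewrite /= foldr_foldr ?(valP v) ?(valP w). Qed.

Lemma free_mul1 : left_id free_one free_mul.
Proof. by move=> u; apply/val_inj. Qed.

Lemma free_mulr1 : right_id free_one free_mul.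
Proof. by move=> u; apply/val_inj; rewrite /= foldr_nil ?(valP u). Qed.

Lemma free_mulV : left_inverse free_one free_inv free_mul.
Proof.
move=> u; apply/val_inj; rewrite /= -[X in foldr _ X _]foldr_nil ?(valP u) //.
exact: foldr_winv.
Qed.

Lemma free_mulrV : right_inverse free_one free_inv free_mul.
Proof.
move=> u; rewrite -{1}[u](_ : free_inv (free_inv u) = u) ?free_mulV //.
by apply/val_inj; rewrite /= winvK.
Qed.

HB.instance Definition _ := isGroup.Build (free X)
  free_mulA free_mul1 free_mulr1 free_mulV free_mulrV.

End FreeGroup.

Record sgraph := SGraph {
  vert :> finType;
  edge : finType;
  src : edge -> vert;
  tgt : edge -> vert;
  erev : edge -> edge;
  erev_neq : forall e, erev e != e;
  erevK : involutive erev;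
  src_erev : forall e, src (erev e) = tgt e;
  tgt_erev : forall e, tgt (erev e) = src e
}.

Record lgraph (X : finType) := LGraph {
  lg_graph :> sgraph;
  lab : edge lg_graph -> letter X;
  lab_erev : forall e, lab (erev e) = linv (lab e)
}.

Record bgraph (X : finType) := BGraph {
  bg_graph :> lgraph X;
  base : bg_graph
}.

Fixpoint is_path (G : sgraph) (u : G) (p : seq (edge G)) (v : G) : Prop :=
  if p is e :: p' then src e = u /\ is_path (tgt e) p' v else u = v.

Definition connected_graph (G : sgraph) : Prop :=
  forall u v : G, exists p, is_path u p v.

Section LabelledGraphs.
Variable X : finType.
Implicit Types G : lgraph X.

Definition covering G : Prop :=
  forall (v : G) (a : letter X), exists! e : edge G, src e = v /\ lab e = a.

Record lmorph (G G' : lgraph X) := LMorph {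
  mvert :> G -> G';
  medge : edge G -> edge G';
  msrc : forall e, src (medge e) = mvert (src e);
  mtgt : forall e, tgt (medge e) = mvert (tgt e);
  merev : forall e, medge (erev e) = erev (medge e);
  mlab : forall e, lab (medge e) = lab e
}.

Definition labelled_subgraph G G' : Prop :=
  exists f : lmorph G G', injective (mvert f) /\ injective (medge f).

Definition acts_to G (u : G) (w : free X) (u' : G) : Prop :=
  exists p, is_path u p u' /\ map (@lab X G) p = w.

(* This determines [D]; the product of permutations is read from left to right,
   as befits the right action of the free group. *)
Definition is_deck_group G (D : {group {perm G}}) : Prop :=
  forall s : {perm G},
    s \in D <-> exists w : free X, forall u : G, acts_to u w (s u).

Definition admissible G (e1 e2 : edge G) : Prop :=
  [/\ e1 <> e2, e2 <> erev e1, src e1 = src e2 & lab e1 = lab e2].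

(* [f : G -> G'] is the quotient map of the folding of [(e1, e2)]. The two edge
   classes [{e1, e2}] and [{erev e1, erev e2}] are disjoint for an admissible
   pair, so the right-hand sides below are equivalence relations. *)
Definition is_folding G G' (e1 e2 : edge G) (f : lmorph G G') : Prop :=
  [/\ forall v', exists v, mvert f v = v',
      forall e', exists e, medge f e = e',
      forall u v, mvert f u = mvert f v <->
        u = v \/ [set u; v] = [set tgt e1; tgt e2]
    & forall d e, medge f d = medge f e <->
        [\/ d = e, [set d; e] = [set e1; e2]
          | [set d; e] = [set erev e1; erev e2]]].

Inductive folds_to (G : bgraph X) : bgraph X -> Prop :=
| folds_refl : folds_to G G
| folds_step (G1 : bgraph X) (G2 : lgraph X) (e1 e2 : edge G1)
    (f : lmorph G1 G2) :
    folds_to G G1 -> admissible e1 e2 -> is_folding e1 e2 f ->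
    folds_to G (BGraph (f (base G1))).

(* The wedge of the cycles labelled by [w 0, ..., w (m - 1)]: [None] is the
   basepoint and [Some (i; k)] the [k+1]-st vertex of the [i]-th cycle; an empty
   word contributes nothing. [((i; k), true)] is the [k]-th edge of the [i]-th
   cycle, traversed in the direction of reading. *)
Section Wedge.
Variables (m : nat) (w : 'I_m -> free X).

Definition wedge_vert : finType := option {i : 'I_m & 'I_(size (w i)).-1}.
Definition wedge_edge : finType := ({i : 'I_m & 'I_(size (w i))} * bool)%type.

Definition cycle_vert (i : 'I_m) (k : nat) : wedge_vert :=
  if k is k'.+1 then
    omap (@Tagged _ i (fun i => 'I_(size (w i)).-1)) (insub k')
  else None.

Definition wedge_end (b : bool) (e : wedge_edge) : wedge_vert :=
  cycle_vert (tag e.1) (if e.2 == b then tagged e.1 : nat else (tagged e.1).+1).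

Definition wedge_rev (e : wedge_edge) : wedge_edge := (e.1, ~~ e.2).

Definition wedge_lab (e : wedge_edge) : letter X :=
  let a := tnth (in_tuple (w (tag e.1))) (tagged e.1) in
  if e.2 then a else linv a.

Lemma wedge_rev_neq e : wedge_rev e != e.
Proof. by case: e => t []; rewrite /wedge_rev xpair_eqE /= andbF. Qed.

Lemma wedge_revK : involutive wedge_rev.
Proof. by case=> t b; rewrite /wedge_rev /= negbK. Qed.

Lemma wedge_src_rev e : wedge_end true (wedge_rev e) = wedge_end false e.
Proof. by case: e => t []. Qed.

Lemma wedge_tgt_rev e : wedge_end false (wedge_rev e) = wedge_end true e.
Proof. by case: e => t []. Qed.

Lemma wedge_lab_rev e : wedge_lab (wedge_rev e) = linv (wedge_lab e).
Proof. by case: e => t []; rewrite /wedge_lab /= ?linvK. Qed.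

Definition wedge : bgraph X :=
  @BGraph X
    (@LGraph X (SGraph wedge_rev_neq wedge_revK wedge_src_rev wedge_tgt_rev)
       wedge_lab wedge_lab_rev)
    None.

End Wedge.

(* [S] is the Stallings graph of [H], obtained from some finite generating
   family of [H] and some maximal sequence of foldings. *)
Definition is_stallings_graph (H : free X -> Prop) (S : bgraph X) : Prop :=
  exists (m : nat) (w : 'I_m -> free X),
    [/\ generates w H, folds_to (wedge w) S
      & forall e1 e2 : edge S, ~ admissible e1 e2].

End LabelledGraphs.

(* Main.v *)
Require Import Defs.
From mathcomp Require Import all_boot all_fingroup.

(** The vertices of the Stallings graph are distinct right cosets [H t_u]: along
    an edge [u -> v] labelled [a] one has [H t_u a = H t_v], and this survives
    every folding.  As the graph is an immersion, distinct vertices carry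
    distinct cosets.  Since [H] is closed, each of the finitely many elements
    [t_u t_v^-1] with [u <> v] lies outside [H N] for some [N] with [F/N] in
    [V]; intersecting these, one [N] works for all pairs.  The coset graph of
    [H N] is then the required covering, and its deck group is a quotient of
    [F/N]. *)

Set Implicit Arguments.
Unset Strict Implicit.
Unset Printing Implicit Defensive.

Local Open Scope group_scope.

(** * Morphisms from a group to a finite group *)

Section GroupMorphisms.
Variables (F : groupType) (gT : finGroupType) (f : F -> gT).
Hypothesis fM : {morph f : x y / x * y}.

Lemma group_morph1 : f 1 = 1.
Proof. by apply: (mulgI (f 1)); rewrite -fM !mulg1. Qed.

Lemma group_morphV x : f x^-1 = (f x)^-1.
Proof. by apply: (mulgI (f x)); rewrite -fM !mulgV group_morph1. Qed.

Lemma preim_subgroup (K : {group gT}) : is_subgroup (fun x => f x \in K).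
Proof.
split=> [|x y Kx Ky|x Kx]; first by rewrite group_morph1 group1.
  by rewrite fM groupM.
by rewrite group_morphV groupV.
Qed.

(** In a finite group every element of a generated subgroup is a product of generators, without
    inverses, so a preimage in [H] is built factor by factor. *)
Lemma gen_morph_image (J : finType) (w : J -> F) (H : F -> Prop) q :
    is_subgroup H -> (forall j, H (w j)) ->
  q \in <<[set f (w j) | j : J]>> -> exists2 x, H x & f x = q.
Proof.
case=> H1 HM _ Hw /gen_prodgP[n [c cP ->]].
elim/big_ind: _ => [|_ _ [x Hx <-] [y Hy <-]|i _].
- by exists 1; rewrite ?group_morph1.
- by exists (x * y); [apply: HM | rewrite fM].
- by have /imsetP[j _ ->] := cP i; exists (w j).
Qed.

End GroupMorphisms.

(** * Words and their values in the free group *)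

Section FreeWords.
Variable X : finType.
Implicit Types (a : letter X) (s : seq (letter X)) (x : free X).

Definition free_letter a : free X := @Free X [:: a] isT.

(** The word [s] may fail to be reduced: labels of paths with backtracking have to be evaluated
    too. *)
Definition free_of_seq s : free X := foldr (fun a x => free_letter a * x) 1 s.

Lemma free_letter_linv a : free_letter (linv a) = (free_letter a)^-1.
Proof. exact/val_inj. Qed.

Lemma word_mul_letter a x : word (free_letter a * x) = push a (word x).
Proof. by []. Qed.

Lemma free_of_seq_cat s1 s2 :
  free_of_seq (s1 ++ s2) = free_of_seq s1 * free_of_seq s2.
Proof. by elim: s1 => [|a s IHs] /=; rewrite ?mul1g // IHs mulgA. Qed.

Lemma free_of_seq_rcons s a :
  free_of_seq (rcons s a) = free_of_seq s * free_letter a.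
Proof. by rewrite -cats1 free_of_seq_cat /= mulg1. Qed.

Lemma free_of_word x : free_of_seq (word x) = x.
Proof.
apply: val_inj; case: x => w rw /=.
have -> : word (free_of_seq w) = foldr (@push X) [::] w.
  by elim: (w) => //= a s <-.
exact: foldr_nil.
Qed.

End FreeWords.

(** * Paths in immersions *)

Section Paths.
Variables (X : finType) (G : lgraph X).
Implicit Types (u v : G) (p q : seq (edge G)).

Definition path_val p : free X := free_of_seq (map (@lab X G) p).

Lemma path_val_cat p q : path_val (p ++ q) = path_val p * path_val q.
Proof. by rewrite /path_val map_cat free_of_seq_cat. Qed.

Lemma is_path_cat u v w p q :
  is_path u p v -> is_path v q w -> is_path u (p ++ q) w.
Proof.
elim: p u => [|e p IHp] u /=; first by move=> ->.
by case=> -> pP qP; split=> //; apply: IHp.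
Qed.

Lemma is_path_rev u p v :
  is_path u p v -> exists2 q, is_path v q u & path_val q = (path_val p)^-1.
Proof.
elim: p u => [|e p IHp] u /=; first by move=> ->; exists [::]; rewrite ?invg1.
case=> <- /IHp[q qP vq]; exists (q ++ [:: erev e]).
  by apply: is_path_cat qP _; rewrite /= src_erev tgt_erev.
rewrite path_val_cat vq /path_val /= mulg1 lab_erev free_letter_linv.
by rewrite invgM.
Qed.

Definition immersion := forall e1 e2 : edge G,
  src e1 = src e2 -> lab e1 = lab e2 -> e1 = e2.

Lemma unfoldable_immersion :
  (forall e1 e2 : edge G, ~ admissible e1 e2) -> immersion.
Proof.
move=> noadm e1 e2 es el; apply/eqP/negPn/negP => /eqP ne.
apply: (noadm e1 e2); split=> // e2E; move: el; rewrite e2E lab_erev => /eqP.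
by rewrite eq_sym (negPf (linv_neq _)).
Qed.

Hypothesis immG : immersion.

(** A new first edge can cancel only against a following edge with inverse label. In an immersion
    that edge is the reverse of the new one, so dropping both keeps the endpoints. *)
Lemma path_reduce u p v : is_path u p v ->
  exists2 q, is_path u q v & map (@lab X G) q = word (path_val p).
Proof.
elim: p u => [|e p IHp] u; first by exists [::].
case=> eu /IHp[q qP lq].
have -> : path_val (e :: p) = free_letter (lab e) * path_val p by [].
rewrite word_mul_letter -lq.
case: q qP {lq} => [|e' q] /=; first by move=> <-; exists [:: e].
case=> se' qP; case: eqP => [le'|_]; last by exists [:: e, e' & q].
exists q => //; suff e'E : e' = erev e by rewrite e'E tgt_erev eu in qP.
by apply: immG; rewrite ?src_erev ?lab_erev.
Qed.

Lemma path_lab_inj u p q v v' : is_path u p v -> is_path u q v' ->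
  map (@lab X G) p = map (@lab X G) q -> v = v'.
Proof.
elim: p u q => [|e p IHp] u [|e' q] //=; first by move=> <- <-.
case=> es pP [es' qP] [le lpq].
have ee' : e = e' by apply: immG; rewrite ?es.
by rewrite -ee' in qP; apply: IHp pP qP lpq.
Qed.

Lemma path_val_inj u p q v v' : is_path u p v -> is_path u q v' ->
  path_val p = path_val q -> v = v'.
Proof.
move=> /path_reduce[p' p'P lp'] /path_reduce[q' q'P lq'] epq.
by apply: path_lab_inj p'P q'P _; rewrite lp' lq' epq.
Qed.

End Paths.

(** * Images of paths under labelled morphisms *)

Section LabelledMorphisms.
Variables (X : finType) (G G' : lgraph X) (f : lmorph G G').

Lemma lmorph_path u p v : is_path u p v -> is_path (f u) (map (medge f) p) (f v).
Proof.
elim: p u => [|e p IHp] u /=; first by move=> ->.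
by case=> <- pP; rewrite msrc mtgt; split=> //; apply: IHp.
Qed.

Lemma lmorph_path_val p : path_val (map (medge f) p) = path_val p.
Proof.
rewrite /path_val -map_comp; congr free_of_seq.
by apply: eq_map => e /=; rewrite mlab.
Qed.

End LabelledMorphisms.

(** * Vertices as right cosets of [H], and their behaviour under folding *)

Section CosetPotentials.
Variables (X : finType) (H : free X -> Prop).
Hypothesis sgH : is_subgroup H.

(** Equality of cosets [H x = H y] is expressed by [H (x * y^-1)]. At the base only membership in
    [H] is asked, not the value 1, because a folding may change representatives. *)
Definition coset_potential (G : bgraph X) (t : G -> free X) :=
  H (t (base G)) /\
  forall e : edge G, H (t (src e) * free_letter (lab e) * (t (tgt e))^-1).

(** The first clause is one half of the equality between [H] and the values of loops at the base; a
    coset potential supplies the other half. *)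
Definition spanned_by_loops (G : bgraph X) :=
  (forall h, H h -> exists2 p, is_path (base G) p (base G) & path_val p = h) /\
  forall v : G, exists p, is_path (base G) p v.

Lemma coset_sym x y : H (x * y^-1) -> H (y * x^-1).
Proof. by case: sgH => _ _ HV /HV; rewrite invgM invgK. Qed.

Lemma coset_trans y x z : H (x * y^-1) -> H (y * z^-1) -> H (x * z^-1).
Proof. by case: sgH => _ HM _ xy /(HM _ _ xy); rewrite mulgA mulgKV. Qed.

Lemma coset_refl x : H (x * x^-1).
Proof. by case: sgH => H1 _ _; rewrite mulgV. Qed.

Lemma coset_mulr x y z : H (x * y^-1) -> H (x * z * (y * z)^-1).
Proof. by rewrite invgM !mulgA mulgK. Qed.

Lemma potential_path (G : bgraph X) (t : G -> free X) u p v :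
  coset_potential t -> is_path u p v -> H (t u * path_val p * (t v)^-1).
Proof.
case=> _ tP; elim: p u => [|e p IHp] u /=.
  by move=> ->; rewrite mulg1; apply: coset_refl.
case=> <- /IHp; apply: coset_trans.
by rewrite /path_val /= mulgA; apply: coset_mulr.
Qed.

(** The two identified targets already carry the same coset, since both are reached from one vertex
    by the same letter. *)
Lemma potential_folding (G : bgraph X) (G' : lgraph X) (e1 e2 : edge G)
    (f : lmorph G G') (t : G -> free X) :
    admissible e1 e2 -> is_folding e1 e2 f -> coset_potential t ->
  exists t' : BGraph (f (base G)) -> free X, coset_potential t'.
Proof.
case=> _ _ es el [fv fe fvE _] [t0 tP].
have t12 : H (t (tgt e1) * (t (tgt e2))^-1).
  by apply: coset_trans (tP e2); apply: coset_sym; rewrite -es -el.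
have tf u v : f u = f v -> H (t u * (t v)^-1).
  case/fvE => [->|uv]; first exact: coset_refl.
  have : (u \in [set u; v]) && (v \in [set u; v]) by rewrite !inE !eqxx orbT.
  rewrite uv !inE => /andP[/orP[]/eqP-> /orP[]/eqP->] //;
    by [apply: coset_refl | apply: coset_sym].
(* An arbitrary section [g] on vertices suffices: by [tf], the choice affects [t] only within a
   coset. *)
have [g gK] : exists g : G' -> G, forall v', f (g v') = v'.
  exact: fin_all_exists fv.
have tg u : H (t u * (t (g (f u)))^-1) by apply: tf; rewrite gK.
exists (fun v => t (g v)); split=> [|e'] /=.
  have := coset_sym (tg (base G)).
  by case: sgH => _ HM _ /HM/(_ t0); rewrite mulgKV.
have [e <-] := fe e'; rewrite msrc mtgt mlab.
apply: coset_trans (tg _); apply: coset_trans (tP e).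
exact/coset_mulr/coset_sym.
Qed.

Lemma spanned_folding (G : bgraph X) (G' : lgraph X) (e1 e2 : edge G)
    (f : lmorph G G') :
    is_folding e1 e2 f -> spanned_by_loops G ->
  spanned_by_loops (BGraph (f (base G))).
Proof.
case=> fv _ _ _ [loops conn]; split=> [h /loops[p pP ph]|v'] /=.
  by exists (map (medge f) p); rewrite ?lmorph_path_val //; apply: lmorph_path.
have [v <-] := fv v'; have [p pP] := conn v.
by exists (map (medge f) p); apply: lmorph_path.
Qed.

Lemma potential_sep (G : bgraph X) (t : G -> free X) u v :
    immersion G -> coset_potential t -> spanned_by_loops G ->
  H (t u * (t v)^-1) -> u = v.
Proof.
move=> immG tP [loops conn] tuv.
have [[p pP] [q qP]] := (conn u, conn v).
have [H1 HM HV] := sgH; have [t0 _] := tP.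
have cov w r : is_path (base G) r w -> H (path_val r * (t w)^-1).
  by move/(potential_path tP)/(HM _ _ (HV _ t0)); rewrite !mulgA mulVg mul1g.
(* The values of [p] and [q] lie in the cosets of [u] and [v], which agree. Hence their quotient is
   read by a loop [l], and [p] and [l ++ q] have equal values, so equal ends. *)
have /loops[l lP vl] : H (path_val p * (path_val q)^-1).
  exact: coset_trans (coset_trans (cov _ _ pP) tuv) (coset_sym (cov _ _ qP)).
apply: (path_val_inj immG pP (is_path_cat lP qP)).
by rewrite path_val_cat vl mulgKV.
Qed.

End CosetPotentials.

(** * The initial wedge of cycles *)

Section WedgeCosets.
Variables (X : finType) (m : nat) (w : 'I_m -> free X) (H : free X -> Prop).
Hypotheses (sgH : is_subgroup H) (genH : generates w H).

Let prefix i k := free_of_seq (take k (word (w i))).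

Definition wedge_potential (v : wedge w) : free X :=
  if v is Some u then prefix (tag u) (tagged u).+1 else 1.

Lemma gen_mem i : H (w i).
Proof. by apply/genH => K _; apply. Qed.

Lemma cycle_vert_size i : cycle_vert w i (size (w i)) = None.
Proof.
have: size (w i) <= size (w i) by [].
(* The end of a cycle falls just outside the range of [insub], whose default [None] is the
   basepoint. *)
case: {2 3}(size (w i)) => //= k le_k; rewrite insubF //.
by apply/negbTE; rewrite -leqNgt; case: (size (w i)) le_k.
Qed.

Lemma wedge_potential_cycle i k :
  k < size (w i) -> wedge_potential (cycle_vert w i k) = prefix i k.
Proof.
case: k => [|k] lt_k /=; first by rewrite /prefix take0.
have lt_k' : k < (size (w i)).-1 by case: (size (w i)) lt_k.
by rewrite insubT.
Qed.

(** Equality holds on the nose except at [k = size (w i)]: there the cycle closes up, the prefix is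
    the whole generator [w i], and the potential is 1. *)
Lemma wedge_potential_cosetP i k : k <= size (w i) ->
  H (prefix i k * (wedge_potential (cycle_vert w i k))^-1).
Proof.
rewrite leq_eqVlt => /predU1P[->|/wedge_potential_cycle->]; last first.
  exact: coset_refl.
rewrite cycle_vert_size /prefix take_size free_of_word /= invg1 mulg1.
exact: gen_mem.
Qed.

Lemma prefixS i (k : 'I_(size (w i))) :
  prefix i k.+1 = prefix i k * free_letter (tnth (in_tuple (w i)) k).
Proof.
have a0 := tnth (in_tuple (w i)) k.
by rewrite (tnth_nth a0) /prefix (take_nth a0) ?free_of_seq_rcons.
Qed.

Lemma wedge_coset_potential : coset_potential H wedge_potential.
Proof.
split=> [|[[i k] b]]; first by case: sgH.
have fwd : H (wedge_potential (cycle_vert w i k)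
    * free_letter (tnth (in_tuple (w i)) k)
    * (wedge_potential (cycle_vert w i k.+1))^-1).
  by rewrite wedge_potential_cycle // -prefixS; apply: wedge_potential_cosetP.
case: b => //=.
rewrite /wedge_end /wedge_lab /= free_letter_linv.
by case: sgH => _ _ /(_ _ fwd); rewrite !invgM invgK mulgA.
Qed.

Lemma wedge_cycle_path i k : k <= size (w i) ->
  exists2 p, is_path (base (wedge w)) p (cycle_vert w i k)
           & path_val p = prefix i k.
Proof.
elim: k => [|k IHk] lt_k; first by exists [::]; rewrite // /prefix take0.
have [p pP vp] := IHk (ltnW lt_k).
pose e : edge (wedge w) := (Tagged (fun i => 'I_(size (w i))) (Ordinal lt_k), true).
exists (p ++ [:: e]); first by apply: is_path_cat pP _.
by rewrite path_val_cat vp (prefixS (Ordinal lt_k)) /path_val /= mulg1.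
Qed.

Lemma wedge_spanned : spanned_by_loops H (wedge w).
Proof.
split=> [h /genH hP|[[i k]|]]; last by exists [::].
  (* The values of loops at the base form a subgroup; it remains to see that it contains the
     generators. *)
  apply: (hP (fun h => exists2 p, is_path (base (wedge w)) p (base (wedge w))
                                 & path_val p = h)) => [|i].
    split=> [|x y [p pP <-] [q qP <-]|x [p /is_path_rev[q qP vq] <-]].
    - by exists [::].
    - by exists (p ++ q); [apply: is_path_cat pP qP | rewrite path_val_cat].
    - by exists q.
  have [p] := wedge_cycle_path (leqnn (size (w i))).
  by rewrite cycle_vert_size /prefix take_size free_of_word; exists p.
have lt_k : k.+1 <= size (w i) by exact: leq_trans (ltn_ord k) (leq_pred _).
have [p] := wedge_cycle_path lt_k.
by rewrite /= valK => pP _; exists p.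
Qed.

End WedgeCosets.

(** Spanning and the existence of a potential are invariants of folding, proved by induction from
    the wedge; the immersion property comes from the maximality of the folding sequence. *)
Lemma stallings_cosets (X : finType) (H : free X -> Prop) (S : bgraph X) :
    is_subgroup H -> is_stallings_graph H S ->
  [/\ immersion S, spanned_by_loops H S
    & exists t : S -> free X, coset_potential H t].
Proof.
move=> sgH [m [w [genH foldS /unfoldable_immersion immS]]]; split=> //.
  elim: foldS => {S immS} [|G1 G2 e1 e2 f _ IH _ ff].
    exact: wedge_spanned.
  exact: spanned_folding ff IH.
elim: foldS => {S immS} [|G1 G2 e1 e2 f _ [t tP] adm ff].
  by exists (wedge_potential (w := w)); apply: wedge_coset_potential.
exact: potential_folding adm ff tP.
Qed.

(** * The coset graph of a finite quotient and its deck group *)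

Section CosetGraph.
Variables (X : finType) (gT : finGroupType) (f : free X -> gT).
Variables (K Q : {group gT}).
Hypotheses (fM : {morph f : x y / x * y}) (fQ : forall x, f x \in Q).
Hypothesis fQ_surj : forall q, q \in Q -> exists x, f x = q.

Definition coset_vert : finType := {A : {set gT} | A \in rcosets K Q}.

Definition coset_act : action _ coset_vert := ('Rs^?)%act.

(** Off its domain the action on the subtype is the identity by default, so translation by [Q] has
    to be shown to preserve the set of cosets. *)
Lemma sub_coset_act_dom : Q \subset subact_dom (fun A => A \in rcosets K Q) 'Rs.
Proof.
rewrite /subact_dom (_ : [set A | _] = rcosets K Q) ?actsRs_rcosets //.
by apply/setP => A; rewrite inE.
Qed.

Lemma val_coset_act (A : coset_vert) q :
  q \in Q -> val (coset_act A q) = val A :* q.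
Proof.
by move=> Qq; rewrite /= val_subact (subsetP sub_coset_act_dom _ Qq) /= rcosetE.
Qed.

Lemma coset_actM (A : coset_vert) x y :
  coset_act A (f (x * y)) = coset_act (coset_act A (f x)) (f y).
Proof.
by apply: val_inj; rewrite !val_coset_act // fM rcosetM.
Qed.

Definition coset_edge : finType := (coset_vert * letter X)%type.

Definition coset_tgt (e : coset_edge) : coset_vert :=
  coset_act e.1 (f (free_letter e.2)).

Definition coset_rev (e : coset_edge) : coset_edge := (coset_tgt e, linv e.2).

Lemma coset_rev_neq e : coset_rev e != e.
Proof. by case: e => A a; rewrite xpair_eqE negb_and linv_neq orbT. Qed.

Lemma coset_tgt_rev e : coset_tgt (coset_rev e) = e.1.
Proof.
rewrite /coset_tgt /= -coset_actM free_letter_linv mulgV group_morph1 //.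
exact: act1.
Qed.

Lemma coset_revK : involutive coset_rev.
Proof. by move=> e; rewrite {1}/coset_rev coset_tgt_rev linvK -surjective_pairing. Qed.

Definition coset_graph : lgraph X :=
  @LGraph X (@SGraph coset_vert coset_edge (fun e => e.1) coset_tgt coset_rev
      coset_rev_neq coset_revK (fun=> erefl) coset_tgt_rev)
    (fun e => e.2) (fun=> erefl).

Lemma coset_graph_covering : covering coset_graph.
Proof. by move=> v a; exists (v, a); split=> // -[u b] /= [-> ->]. Qed.

Lemma coset_graph_path (u : coset_graph) s : exists p : seq (edge coset_graph),
  is_path u p (coset_act u (f (free_of_seq s))) /\ map (@lab X coset_graph) p = s.
Proof.
elim: s u => [|a s IHs] u /=.
  by exists [::]; split=> //=; rewrite group_morph1 // act1.
have [p [pP lp]] := IHs (coset_tgt (u, a)).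
by exists ((u, a) :: p); rewrite /= lp coset_actM.
Qed.

Lemma coset_graph_acts (u u' : coset_graph) x :
  acts_to u x u' <-> u' = coset_act u (f x).
Proof.
have [p [pP lp]] := coset_graph_path u (word x); rewrite free_of_word in pP.
split=> [[q [qP lq]]|->]; last by exists p.
apply: path_lab_inj qP pP _; last by rewrite lp.
by move=> [A a] [B b] /= -> ->.
Qed.

Lemma coset_graph_connected : connected_graph coset_graph.
Proof.
move=> u v; have /rcosetsP[x Qx uE] := valP u; have /rcosetsP[y Qy vE] := valP v.
have [g gE] := fQ_surj (groupM (groupVr Qx) Qy).
have [p [pP _]] := coset_graph_path u (word g); exists p.
rewrite free_of_word gE in pP; rewrite (_ : v = coset_act u (x^-1 * y)) //.
apply: val_inj; rewrite val_coset_act ?groupM ?groupV //.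
by rewrite uE vE -rcosetM mulKVg.
Qed.

Definition coset_deck : {group {perm coset_graph}} := (actperm coset_act @* Q)%G.

Lemma coset_deckP : is_deck_group coset_deck.
Proof.
move=> s; split=> [/morphimP[q _ /fQ_surj[x <-] ->]|[x sx]].
  by exists x => u; apply/coset_graph_acts; rewrite actpermE.
have -> : s = actperm coset_act (f x).
  by apply/permP => u; rewrite actpermE; apply/coset_graph_acts.
by apply: mem_morphim => //; apply: (subsetP sub_coset_act_dom).
Qed.

(** By the first isomorphism theorem the deck group is [Q] modulo the kernel of its action on
    cosets. *)
Lemma coset_deck_in (V : group_class) : pseudovariety V -> V gT Q -> V _ coset_deck.
Proof.
move=> pvV VQ.
pose phi := restrm_morphism sub_coset_act_dom (actperm_morphism coset_act).
apply: (pv_isog pvV) (pv_quo pvV (ker_normal phi) VQ).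
by have := first_isog phi; rewrite /phi /= morphim_restrm setIid.
Qed.

(** The embedding sends [u] to the coset of [f (t u)]. It respects edges because [f] maps [H] into
    [K]; once it is injective on vertices, immersion makes it injective on edges. *)
Lemma potential_coset_subgraph (S : bgraph X) (H : free X -> Prop)
    (t : S -> free X) :
    coset_potential H t -> immersion S ->
    (forall x, H x -> f x \in K) ->
    (forall u v, f (t u * (t v)^-1) \in K -> u = v) ->
  labelled_subgraph S coset_graph.
Proof.
move=> [_ tP] immS HK tK.
have tV u : K :* f (t u) \in rcosets K Q by apply/rcosetsP; exists (f (t u)).
pose fv u : coset_graph := Sub (K :* f (t u)) (tV u).
pose fe (e : edge S) : edge coset_graph := (fv (src e), lab e).
have fe_tgt e : tgt (fe e) = fv (tgt e).
  apply: val_inj; rewrite /= /coset_tgt val_coset_act //= -rcosetM -fM.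
  by apply/rcoset_eqP; rewrite mem_rcoset -group_morphV // -fM HK.
have fe_rev e : fe (erev e) = erev (fe e).
  by rewrite {1}/fe src_erev lab_erev -fe_tgt.
exists (@LMorph X S coset_graph fv fe (fun=> erefl) fe_tgt fe_rev (fun=> erefl)).
have fv_inj : injective fv.
  move=> u v /(congr1 val) /= /rcoset_eqP; rewrite mem_rcoset -group_morphV //.
  by rewrite -fM => /tK.
split=> //= e1 e2 [] /rcoset_eqP.
by rewrite mem_rcoset -group_morphV // -fM => /tK; apply: immS.
Qed.

End CosetGraph.

(** Closedness gives one finite quotient for each [g i]; the image of the free group in their
    product separates all of them from [H] at once. *)
Lemma proV_separation (V : group_class) (X : finType) (H : free X -> Prop)
    (I : finType) (g : I -> free X) :
    pseudovariety V -> proV_closed V H -> (forall i, ~ H (g i)) ->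
  exists (gT : finGroupType) (Q : {group gT}) (f : free X -> gT),
    [/\ {morph f : x y / x * y}, forall x, f x \in Q,
        forall q, q \in Q -> exists x, f x = q, V gT Q
      & forall i h, H h -> f h <> f (g i)].
Proof.
move=> pvV clH Hg.
have /fin_all_exists[gT /fin_all_exists[Q /fin_all_exists[f fP]]] i :
    exists (gT : finGroupType) (Q : {group gT}) (f : free X -> gT),
    [/\ {morph f : x y / x * y}, forall x, f x \in Q, V gT Q
      & forall h, H h -> f h <> f (g i)].
  have [N [_ [gT [Q [f [fM fQ fN VQ]]]] gN]] := clH _ (Hg i).
  exists gT, Q, f; split=> // [x|h Hh fhg]; first by apply/fQ; exists x.
  apply: (gN ((g i)^-1 * h)); last by rewrite mulKVg.
  by apply/fN; rewrite fM group_morphV // fhg mulVg.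
pose F x : {dffun forall i, gT i} := [ffun i => f i x].
have FM : {morph F : x y / x * y}.
  by move=> x y; apply/ffunP => i; rewrite !ffunE; case: (fP i).
(* [F] need not be onto the product; [R] is its image, which lies in [V] as a subgroup of the
   product of the [Q i]. *)
pose R := <<[set F (free_letter a) | a : letter X]>>%G.
exists _, R, F; split=> //.
- move=> x; rewrite -(free_of_word x); elim: (word x) => [|a s IHs] /=.
    by rewrite group_morph1 ?group1.
  by rewrite FM groupM // mem_gen // imset_f.
- move=> q Rq; have sgT : is_subgroup (fun _ : free X => True) by [].
  by have [//|x _ <-] := gen_morph_image FM sgT _ Rq; exists x.
- have VX : V _ (setXn_group Q) by apply: (pv_prod pvV) => i; case: (fP i).
  apply: (pv_sub pvV) VX; rewrite gen_subG; apply/subsetP => _ /imsetP[a _ ->].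
  by apply/setXnP => i; rewrite ffunE; case: (fP i).
move=> i h Hh /ffunP/(_ i); rewrite !ffunE.
by case: (fP i) => _ _ _; apply.
Qed.

Theorem lemma1p11 (V : group_class) (X : finType) (H : free X -> Prop)
    (S : bgraph X) :
  pseudovariety V ->
  closed_abelian_ext V ->
  is_subgroup H ->
  finitely_generated H ->
  proV_closed V H ->
  is_stallings_graph H S ->
  exists Splus : lgraph X,
    [/\ labelled_subgraph S Splus,
        connected_graph Splus,
        covering Splus
      & exists D : {group {perm Splus}}, is_deck_group D /\ V _ D].
Proof.
move=> pvV _ sgH [m [w genH]] clH /(stallings_cosets sgH)[immS spS [t tP]].
(* One element to separate from [H] for each ordered pair of distinct vertices. *)
pose I : finType := {uv : S * S | uv.1 != uv.2}.
pose g (i : I) := t (val i).1 * (t (val i).2)^-1.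
have Hg i : ~ H (g i).
  by move=> /(potential_sep sgH immS tP spS)/eqP; apply/negP/(valP i).
have [gT [Q [f [fM fQ fQs VQ fsep]]]] := proV_separation pvV clH Hg.
(* [K] is the image of [H], so its preimage under [f] is [H N] with [N] the kernel of [f]. *)
pose K := <<[set f (w i) | i : 'I_m]>>%G.
have HK x : H x -> f x \in K.
  move=> /genH gx; apply: (gx (fun x => f x \in K)); first exact: preim_subgroup.
  by move=> i; rewrite mem_gen // imset_f.
exists (coset_graph K fM fQ); split.
- apply: potential_coset_subgraph tP immS HK _ => u v.
  move=> /(gen_morph_image fM sgH (gen_mem genH))[h Hh fh].
  apply/eqP/negPn/negP => neq_uv.
  exact: (fsep (Sub (u, v) neq_uv) h Hh).
- exact: coset_graph_connected.
- exact: coset_graph_covering.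
- exists (coset_deck K fM fQ); split; first exact: coset_deckP.
  exact: coset_deck_in.
Qed.
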